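(* Let $m \geq 4$ be an integer. Then $\alpha\left(W_{m,1}^{(2)}\right)=\left\lfloor \frac{m}{2}\left\lfloor \frac{m}{2}\right\rfloor \right\rfloor$.
   Context: Graphs are finite and simple. For a graph $G$, the double vertex graph $G^{(2)}$ is the graph whose vertices are all $2$-subsets of $V(G)$, where two $2$-subsets are adjacent whenever their symmetric difference is (the set of endpoints of) an edge of $G$. The wheel graph $W_{m,1}$ is the join $C_m+K_1$, where $C_m$ is the cycle with $m$ vertices and $K_1$ is the complete graph with one vertex (the join of two disjoint graphs adds all edges between them). $\alpha(G)$ denotes the independence number of $G$, i.e. the maximum cardinality of a set of pairwise non-adjacent vertices. *)

(* Defs.v *)
From mathcomp Require Import all_boot.

Set Implicit Arguments.
Unset Strict Implicit.
Unset Printing Implicit Defensive.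

Record sgraph := SGraph {
  vertex :> finType;
  adj : rel vertex;
  adj_sym : symmetric adj;
  adj_irrefl : irreflexive adj
}.

Definition independent (G : sgraph) (S : {set G}) : bool :=
  [forall x in S, forall y in S, ~~ adj x y].

Definition alpha (G : sgraph) : nat :=
  \max_(S : {set G} | independent S) #|S|.

                                                                           
                                                              
Definition cycle_adj (m : nat) : rel 'I_m :=
  fun i j => (i != j) && ((j == ordS i) || (i == ordS j)).

Fact cycle_adj_sym (m : nat) : symmetric (@cycle_adj m).
Proof. by move=> i j; rewrite /cycle_adj eq_sym orbC. Qed.

Fact cycle_adj_irrefl (m : nat) : irreflexive (@cycle_adj m).
Proof. by move=> i; rewrite /cycle_adj eqxx. Qed.

Definition cycle_graph (m : nat) : sgraph :=
  SGraph (@cycle_adj_sym m) (@cycle_adj_irrefl m).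

Definition complete_adj (n : nat) : rel 'I_n := fun i j => i != j.

Fact complete_adj_sym (n : nat) : symmetric (@complete_adj n).
Proof. by move=> i j; rewrite /complete_adj eq_sym. Qed.

Fact complete_adj_irrefl (n : nat) : irreflexive (@complete_adj n).
Proof. by move=> i; rewrite /complete_adj eqxx. Qed.

Definition complete_graph (n : nat) : sgraph :=
  SGraph (@complete_adj_sym n) (@complete_adj_irrefl n).

Definition join_adj (G H : sgraph) : rel (G + H)%type :=
  fun u v => match u, v with
             | inl x, inl y => adj x y
             | inr x, inr y => adj x y
             | _, _ => true
             end.

Fact join_adj_sym (G H : sgraph) : symmetric (@join_adj G H).
Proof. by move=> [x|x] [y|y] //=; apply: adj_sym. Qed.

Fact join_adj_irrefl (G H : sgraph) : irreflexive (@join_adj G H).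
Proof. by move=> [x|x] /=; apply: adj_irrefl. Qed.

Definition join_graph (G H : sgraph) : sgraph :=
  SGraph (@join_adj_sym G H) (@join_adj_irrefl G H).

Definition wheel_graph (m : nat) : sgraph :=
  join_graph (cycle_graph m) (complete_graph 1).

Definition symdiff (T : finType) (A B : {set T}) : {set T} :=
  (A :\: B) :|: (B :\: A).

Definition pair_of (G : sgraph) : finType := {A : {set G} | #|A| == 2}.

Definition double_vertex_adj (G : sgraph) : rel (pair_of G) :=
  fun A B =>
    [exists x : G, exists y : G,
       adj x y && (symdiff (val A) (val B) == [set x; y])].

Fact double_vertex_adj_sym (G : sgraph) : symmetric (@double_vertex_adj G).
Proof. by move=> A B; rewrite /double_vertex_adj /symdiff setUC. Qed.

Fact double_vertex_adj_irrefl (G : sgraph) :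
  irreflexive (@double_vertex_adj G).
Proof.
move=> A; apply/negbTE/existsP => -[x] /existsP[y] /andP[_ /eqP/setP/(_ x)].
by rewrite /symdiff setDv setU0 !inE eqxx.
Qed.

Definition double_vertex_graph (G : sgraph) : sgraph :=
  SGraph (@double_vertex_adj_sym G) (@double_vertex_adj_irrefl G).

(* Main.v *)
(** Upper bound: if S is independent in G^(2), then the set of partners
    [row S v = {u | {v, u} in S}] of each vertex v is independent in G, and the
    sizes of these sets add up to 2 |S|.  In the wheel an independent set has at
    most k = m./2 elements, and only one if it contains the hub; so each rim
    vertex contributes at most k, including its possible membership in the
    partner set of the hub, because 1 + 1 <= k.  Hence 2 |S| <= m k.

    Lower bound: pairs {i, j} of rim vertices at odd cyclic distance are
    independent, except that for odd m and odd k the pairs at distance k induce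
    an odd cycle; there we keep the k pairs with |i - j| = k + 1. *)

Require Import Defs.
From mathcomp Require Import all_boot all_order all_algebra.
From mathcomp Require Import zify lra.

Set Implicit Arguments.
Unset Strict Implicit.
Unset Printing Implicit Defensive.

(** * Partner sets and adjacency in a double vertex graph *)

Section DoubleVertexGraph.

Variable G : sgraph.
Implicit Types (S : {set double_vertex_graph G}) (A B : double_vertex_graph G).

Lemma independentP (H : sgraph) (S : {set H}) :
  reflect {in S &, forall x y, ~~ adj x y} (independent S).
Proof.
apply: (iffP idP) => [/forall_inP h x y xS yS|h].
  by have /forall_inP := h x xS; apply.
by apply/forall_inP => x xS; apply/forall_inP => y; apply: h.
Qed.

Lemma adj_neq (H : sgraph) (x y : H) : adj x y -> x != y.
Proof. by apply: contraTneq => ->; rewrite adj_irrefl. Qed.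

Definition row S (v : G) : {set G} :=
  [set u | (u != v) && ([set v; u] \in val @: S)].

Lemma row_sym S u v : (u \in row S v) = (v \in row S u).
Proof. by rewrite !inE eq_sym setUC. Qed.

Lemma row_irrefl S v : v \notin row S v.
Proof. by rewrite inE eqxx. Qed.

(** An edge between partners x and y of v would be the symmetric difference of {v, x} and {v, y}. *)
Lemma row_independent S v : independent S -> independent (row S v).
Proof.
move/independentP=> indS; apply/independentP => x y.
rewrite !inE => /andP[xv /imsetP[A AS eA]] /andP[yv /imsetP[B BS eB]].
apply: contraNN (indS _ _ AS BS) => xy.
apply/existsP; exists x; apply/existsP; exists y; rewrite xy -eA -eB /=.
have nxy := adj_neq xy.
apply/eqP/setP => z; rewrite /symdiff !inE.
have [->|zv] /= := eqVneq z v.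
  by rewrite ![v == _]eq_sym (negbTE xv) (negbTE yv).
have [->|zx] /= := eqVneq z x; first by rewrite (negbTE nxy).
by rewrite andbF.
Qed.

(** Count the incidences of v with A in S in two ways: each A has two elements, and the members of S
    through v lie among the images of [row S v] under u |-> {v, u}. *)
Lemma card2_row_sum S : 2 * #|S| <= \sum_v #|row S v|.
Proof.
have -> : 2 * #|S| = \sum_(A in S) #|val A|.
  by rewrite mulnC -sum_nat_const; apply: eq_bigr => A _; rewrite (eqP (valP A)).
have -> : \sum_(A in S) #|val A| = \sum_(v : G) #|[set A in S | v \in val A]|.
  under eq_bigr do rewrite -sum1_card big_mkcond.
  rewrite exchange_big /=; apply: eq_bigr => v _.
  by rewrite -sum1_card -big_mkcondr /=; apply: eq_bigl => A; rewrite inE.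
apply: leq_sum => v _.
rewrite -(card_imset _ val_inj).
apply: leq_trans (leq_imset_card (fun u => [set v; u]) _).
apply: subset_leq_card; apply/subsetP => _ /imsetP[A /setIdP[AS vA] ->].
have /cards2P[a [b [ab eA]]] := valP A.
have bin u : u != v -> val A = [set v; u] ->
    val A \in [set [set v; u] | u in row S v].
  move=> uv e; apply/imsetP; exists u => //.
  by rewrite inE uv -e imset_f.
move: vA; rewrite {1}eA !inE => /orP[] /eqP ev.
  by apply: (bin b); rewrite ev // eq_sym.
by apply: (bin a); rewrite ev // setUC.
Qed.

Lemma double_vertex_adjP A B :
  adj A B -> exists z x y : G,
    [/\ adj x y, val A = [set z; x] & val B = [set z; y]].
Proof.
case/existsP=> x /existsP[y /andP[xy /eqP/setP eAB]].
have {eAB} eAB z : ((z == x) || (z == y)) = (z \in val A) (+) (z \in val B).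
  by have := eAB z; rewrite /symdiff !inE; do 2 case: (z \in _).
have nxy := adj_neq xy.
have hx : (x \in val A) (+) (x \in val B) by rewrite -eAB eqxx.
have hy : (y \in val A) (+) (y \in val B) by rewrite -eAB eqxx orbT.
have other (C : pair_of G) : #|val C| == 2 -> forall v : G, v \in val C ->
    exists2 z, z != v & val C = [set z; v].
  move=> /cards2P[c [c' [ncc ->]]] v; rewrite !inE => /orP[]/eqP->.
    by exists c'; rewrite 1?eq_sym // setUC.
  by exists c.
(* The element z of C other than u is neither u nor v, hence outside the symmetric difference and so
   also in D. *)
have mixed (C D : pair_of G) (u v : G) : u != v ->
    (forall z, ((z == u) || (z == v)) = (z \in val C) (+) (z \in val D)) ->
    u \in val C -> v \in val D -> v \notin val C ->
    exists z, val C = [set z; u] /\ val D = [set z; v].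
  move=> uv e uC vD vC.
  have [z zu eC] := other C (valP C) u uC.
  have zC : z \in val C by rewrite eC !inE eqxx.
  have zv : z != v by apply: contraNneq vC => <-.
  have zD : z \in val D.
    by have := e z; rewrite zC (negbTE zu) (negbTE zv); case: (z \in val D).
  have [w wv eD] := other D (valP D) v vD.
  exists z; split=> //; rewrite eD.
  by move: zD; rewrite eD !inE (negbTE zv) orbF => /eqP->.
(* Here C = {x, y} and D avoids both, so any d in D would be a third element of the symmetric
   difference. *)
have same (C D : pair_of G) :
    (forall z, ((z == x) || (z == y)) = (z \in val C) (+) (z \in val D)) ->
    x \in val C -> y \in val C -> False.
  move=> e xC yC.
  have /card_gt0P[d dD] : 0 < #|val D| by rewrite (eqP (valP D)).
  have hd := e d; have := e x; have := e y.
  rewrite !eqxx orbT xC yC /= => /esym yD /esym xD.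
  have dx : d != x by apply: contraTneq dD => ->.
  have dy : d != y by apply: contraTneq dD => ->.
  have [z zx eC] := other C (valP C) x xC.
  move: yC hd; rewrite eC dD !inE [y == x]eq_sym (negbTE nxy) orbF => /eqP <-.
  by rewrite (negbTE dx) (negbTE dy).
have eBA z : ((z == x) || (z == y)) = (z \in val B) (+) (z \in val A).
  by rewrite eAB addbC.
have [xA|xA] := boolP (x \in val A); have [yA|yA] := boolP (y \in val A).
- by case: (same A B).
- have yB : y \in val B by move: hy; rewrite (negbTE yA).
  by have [z [-> ->]] := mixed A B x y nxy eAB xA yB yA; exists z, x, y.
- have xB : x \in val B by move: hx; rewrite (negbTE xA).
  have [||z [-> ->]] := mixed A B y x _ _ yA xB xA.
  + by rewrite eq_sym.
  + by move=> z; rewrite orbC.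
  by exists z, y, x; rewrite adj_sym.
- case: (same B A) => //; first by move: hx; rewrite (negbTE xA).
  by move: hy; rewrite (negbTE yA).
Qed.

End DoubleVertexGraph.

(** * Independent sets in cycles and wheels, and the upper bound *)

Lemma ordS_cases (m : nat) (i : 'I_m) :
  ordS i = i.+1 :> nat \/ i.+1 = m /\ ordS i = 0 :> nat.
Proof.
have := ltn_ord i; rewrite leq_eqVlt => /orP[/eqP e|lt].
  by right; rewrite /= e modnn.
by left; rewrite /= modn_small.
Qed.

(** R is disjoint from its rotation by one step, which has the same size, and both fit into m
    vertices. *)
Lemma card_cycle_independent (m : nat) (R : {set cycle_graph m}) :
  1 < m -> independent R -> #|R| <= m./2.
Proof.
move=> m1 /independentP indR.
have injS : injective (@ordS m) by apply: bij_inj; apply: ordS_bij.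
have dis : [disjoint R & @ordS m @: R].
  apply/pred0P => x /=; apply/negbTE; apply/negP => /andP[xR /imsetP[y yR exy]].
  have /negP := indR _ _ yR xR; apply; rewrite /= /cycle_adj exy eqxx andbT.
  by apply/eqP => /(congr1 val) /= e; case: (ordS_cases y) => /=; rewrite -e; lia.
have := max_card [in R :|: @ordS m @: R].
rewrite cardsU (disjoint_setI0 dis) cards0 subn0 card_imset // card_ord.
rewrite -[#|_| + _]/(#|R| + #|R|); lia.
Qed.

Definition hub (m : nat) : wheel_graph m := inr ord0.

Lemma card_wheel_independent_hub (m : nat) (R : {set wheel_graph m}) :
  independent R -> hub m \in R -> #|R| <= 1.
Proof.
move=> /independentP indR hR; rewrite -(cards1 (hub m)).
apply/subset_leq_card/subsetP => -[i|i] iR; first by have := indR _ _ hR iR.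
by rewrite ord1 inE.
Qed.

Lemma card_wheel_rim (m : nat) (R : {set wheel_graph m}) :
  hub m \notin R -> #|R| = #|[set i : cycle_graph m | inl i \in R]|.
Proof.
move=> hR; pose f (i : cycle_graph m) : wheel_graph m := inl i.
have injf : injective f by move=> i j [].
rewrite -(card_imset _ injf); congr #|pred_of_set _|; apply/setP => -[i|i].
  by rewrite (mem_imset _ _ injf) inE.
by rewrite ord1 (negbTE hR); apply/esym/negbTE/imsetP => -[].
Qed.

Lemma card_wheel_independent (m : nat) (R : {set wheel_graph m}) :
  1 < m -> independent R -> #|R| <= m./2.
Proof.
move=> m1 indR; have [hR|hR] := boolP (hub m \in R).
  by have := card_wheel_independent_hub indR hR; lia.
rewrite card_wheel_rim //; apply: card_cycle_independent => //.
move/independentP: indR => indR; apply/independentP => i j.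
by rewrite !inE => iR jR; apply: (indR (inl i) (inl j)).
Qed.

Lemma alpha_wheel_le (m : nat) : 4 <= m ->
  alpha (double_vertex_graph (wheel_graph m)) <= (m * m./2)./2.
Proof.
move=> hm; apply/bigmax_leqP => S indS.
suff : 2 * #|S| <= m * m./2 by lia.
apply: leq_trans (card2_row_sum S) _.
rewrite big_sumType /= big_ord1 -/(hub m) card_wheel_rim ?row_irrefl //.
(* The hub's partners are charged one unit each to the rim vertex concerned, which leaves a sum of m
   terms. *)
rewrite -sum1_card [X in _ + X <= _]big_mkcond addnC -big_split /=.
rewrite -[X in _ <= X * _]card_ord -sum_nat_const; apply: leq_sum => i _.
rewrite in_set (row_sym S (inl i : wheel_graph m) (hub m)).
have [hi|_] := boolP (hub m \in _).
  apply: (@leq_trans (1 + 1)); last lia.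
  by rewrite leq_add2l (card_wheel_independent_hub _ hi) ?row_independent.
by rewrite add0n card_wheel_independent ?row_independent //; lia.
Qed.

(** * The family of rim pairs and the lower bound *)

(* [e] stands for |i - j|; for odd m, an even e > m./2 means that the cyclic
   distance m - e is odd and at most m./2. *)
Definition good (m e : nat) : bool :=
  odd e && (~~ odd m || (e < m./2)) || [&& odd m, ~~ odd e & m./2 < e].

(** With truncated subtraction the sum is e = |z - x|. A rim step changes e by one, or sends it to m
    - 1 - e when it wraps around. For even m both flip the parity. For odd m, good values are odd
    below m./2 and even above it: consecutive ones would need opposite sides of m./2, while wrapping
    keeps the parity but reflects e in m./2. *)
Lemma good_adj (m : nat) (z x y : 'I_m) : cycle_adj x y ->
  good m ((z - x) + (x - z)) -> ~~ good m ((z - y) + (y - z)).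
Proof.
have step (a b c : nat) : b < m -> c < m -> b = a.+1 \/ a.+1 = m /\ b = 0 ->
    ~~ (good m ((c - a) + (a - c)) && good m ((c - b) + (b - c))).
  rewrite /good; lia.
case/andP=> _ /orP[] /eqP e gx; apply/negP => gy.
  have := step x y z (ltn_ord _) (ltn_ord _); rewrite gx gy e => h.
  by have := h (ordS_cases x).
have := step y x z (ltn_ord _) (ltn_ord _); rewrite gx gy e => h.
by have := h (ordS_cases y).
Qed.

(** The differences j - i run through 1, ..., j. For odd m, counting switches from odd to even
    values at m./2, and from there on the count is j./2. *)
Lemma sum_good_lt (m j : nat) : j < m ->
  \sum_(i < j) good m (j - i) =
  j./2 + (odd j && (~~ odd m || (j < m./2))).
Proof.
move=> jm; rewrite (reindex_inj rev_ord_inj) /=.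
rewrite (eq_bigr (fun i : 'I_j => good m i.+1 : nat)); last first.
  by move=> i _; rewrite subKn.
elim: j jm => [|j IH] jm; first by rewrite big_ord0.
rewrite big_ord_recr /= IH; last lia.
rewrite /good; lia.
Qed.

Lemma sum_good (m : nat) :
  \sum_(j < m) \sum_(i < j) good m (j - i) = (m * m./2)./2.
Proof.
(* For even m the bound j < k always holds, so one formula serves both parities. *)
pose k := if odd m then m./2 else m.
rewrite (eq_bigr (fun j : 'I_m => j./2 + (odd j && (j < k)))); last first.
  by move=> j _; rewrite sum_good_lt // /k; have := ltn_ord j; case: (odd m); lia.
have sum_odd n : \sum_(j < n) (odd j && (j < k)) = (minn n k)./2.
  by elim: n => [|n IH]; rewrite ?big_ord0 ?min0n // big_ord_recr /= IH; lia.
have sum_half n : \sum_(j < n) j./2 = n./2 * n.-1./2.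
  by elim: n => [|[|n] IH]; rewrite ?big_ord0 // big_ord_recr /= IH //=; nia.
rewrite big_split /= sum_odd sum_half /k.
have [mo|me] := boolP (odd m).
  have -> : m = m./2.*2.+1 by lia.
  move: (m./2) => n; rewrite /= uphalf_double half_double; nia.
have -> : m = m./2.*2 by lia.
move: (m./2) => n; rewrite /= !half_double; case: n => // n.
by rewrite doubleS /= uphalf_double; nia.
Qed.

Lemma alpha_wheel_ge (m : nat) :
  (m * m./2)./2 <= alpha (double_vertex_graph (wheel_graph m)).
Proof.
pose rim (i j : 'I_m) : {set wheel_graph m} := [set inl i; inl j].
pose dist (i j : 'I_m) := (i - j) + (j - i).
have distC i j : dist i j = dist j i by rewrite /dist addnC.
have good_neq i j : good m (dist i j) -> i != j.
  by apply: contraTneq => ->; rewrite /dist subnn /good; lia.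
have card_rim i j : i != j -> #|rim i j| == 2.
  by move=> ij; rewrite cards2 (inj_eq (@inl_inj _ _)) ij.
pose S : {set double_vertex_graph (wheel_graph m)} :=
  [set A | [exists i, exists j, good m (dist i j) && (val A == rim i j)]].
have inS A : A \in S -> forall z x, val A = [set z; x] ->
    exists i j, [/\ z = inl i, x = inl j & good m (dist i j)].
  rewrite inE => /existsP[i /existsP[j /andP[gij /eqP eA]]] z x e.
  have zx : z != x by have := valP A; rewrite e cards2; case: (z != x).
  have : x \in rim i j by rewrite -eA e !inE eqxx orbT.
  have : z \in rim i j by rewrite -eA e !inE eqxx.
  rewrite !inE => /orP[]/eqP ez /orP[]/eqP ex; move: zx; rewrite ez ex ?eqxx // => _.
    by exists i, j.
  by exists j, i; rewrite distC.
have indS : independent S.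
  apply/independentP => A B /inS AS /inS BS; apply/negP.
  (* Adjacent members share a rim vertex z, and their other ends x and y are neighbours, against
     [good_adj]. *)
  move=> /double_vertex_adjP[z [x [y [xy /AS zx /BS zy]]]].
  case: zx zy => [i [j [ez ex gx]]] [i' [l [ez' ey gy]]].
  move: xy; rewrite ex ey => /good_adj/(_ gx)/negP; apply.
  by move: ez'; rewrite ez => -[->].
apply: leq_trans (leq_bigmax_cond _ indS).
rewrite -sum_good -(card_imset _ val_inj).
(* Ordering each pair by p.2 < p.1 makes [rim] injective on [T]. *)
pose T := [set p : 'I_m * 'I_m | (p.2 < p.1) && good m (p.1 - p.2)].
have -> : \sum_(j < m) \sum_(i < j) good m (j - i) = #|T|.
  rewrite -sum1_card.
  under [RHS]eq_bigl => p do rewrite inE.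
  rewrite -(pair_big_dep xpredT
    (fun j i : 'I_m => (i < j) && good m (j - i)) (fun _ _ => 1)) /=.
  apply: eq_bigr => j _.
  rewrite (big_ord_widen_cond m xpredT (fun i => good m (j - i) : nat));
    last exact: ltnW.
  by rewrite [RHS]big_mkcondr /=; apply: eq_bigr => i _; case: good.
have injT : {in T &, injective (fun p => rim p.1 p.2)}.
  move=> [j i] [j' i']; rewrite !inE /= => /andP[ij _] /andP[ij' _] /setP e.
  have := e (inl i); have := e (inl j).
  rewrite !inE !eqxx orbT /= !(inj_eq (@inl_inj _ _)).
  move=> /esym/orP[]/eqP ej /esym/orP[]/eqP ei; move: ij; rewrite ej ei ?ltnn //.
  by move: ij' => /ltnW; rewrite leqNgt => /negbTE ->.
rewrite -(card_in_imset injT); apply/subset_leq_card/subsetP => X /imsetP[[j i]].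
rewrite inE /= => /andP[ij g] ->.
have gd : good m (dist j i) by rewrite /dist (eqP (ltnW ij)) addn0.
have c2 := card_rim _ _ (good_neq _ _ gd).
apply/imsetP; exists (Sub (rim j i) c2 : pair_of (wheel_graph m));
  last by rewrite SubK.
by rewrite inE; apply/existsP; exists j; apply/existsP; exists i; rewrite gd SubK eqxx.
Qed.

Unset Implicit Arguments.

(** * From natural-number halves to rational floors *)

Local Open Scope ring_scope.

Lemma floor_half (n : nat) : Num.floor (n%:Q / 2) = n./2%:Z.
Proof.
have n_eq : n%:R = (odd n)%:R + n./2%:R * 2 :> rat.
  by rewrite -GRing.natrM -GRing.natrD muln2 odd_double_half.
apply: Num.Theory.floor_def; rewrite GRing.rmorphD /= -!pmulrn n_eq.
by case: (odd n) => /=; lra.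
Qed.

Theorem theorem1p2 (m : nat) (hm : (4 <= m)%N) :
  (alpha (double_vertex_graph (wheel_graph m)))%:Z =
  Num.floor (m%:Q / 2 * (Num.floor (m%:Q / 2))%:~R).
Proof.
rewrite floor_half.
(* Once the inner floor is m./2, the outer argument is half of a natural number too. *)
have -> : m%:Q / 2 * (m./2%:Z)%:~R = (m * m./2)%N%:Q / 2.
  by rewrite PoszM GRing.rmorphM /= GRing.mulrAC.
rewrite floor_half; congr Posz; apply/eqP.
by rewrite eqn_leq alpha_wheel_le ?alpha_wheel_ge.
Qed.
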